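(* Let the graphs $G_i$, $G=\bigsqcup_iG_i$, the even integer $j$, $\sigma>0$ and $p\ge2$ be as in the context, and let $\alpha$ be a labeling for which property $(\mathrm P_p)$ holds. Let $(Y,d_Y)$ be a complete geodesic $p$-uniformly convex metric space such that $\Lambda^{(p)}_Y(\sigma)<\infty$ or, more generally, $$\lim_{N\to\infty}\Big(\frac{\log\log N}{\log N}\Big)^{\frac1{2p}}\Lambda^{(p)}_Y(\sigma,N)=0.$$ Then every isometric action of $\Gamma_\alpha$ on $Y$ fixes a point.
   Context: $\{G_i\}$: connected non-bipartite finite graphs on $N_i\to\infty$ vertices, degrees in $[3,d]$, spectral gaps $\ge\sigma$, girths $\ge c\log N_i$. $\Gamma$ is free on a symmetric set $S$ of size $2k$, $X=\mathrm{Cay}(\Gamma,S)$, $\mu_X(x\to xs)=\frac1{2k}$, $\mu_X^n$ its convolution powers. A labeling $\alpha$ assigns to each oriented edge of $G$ an element of $S^j$ (word of length $j$) with reverse edges getting inverses; $\Gamma_\alpha$ is the quotient of $\Gamma$ by the normal closure of the products of labels along cycles of $G$. $\Gamma$ acts on $Y$ via $\Gamma\to\Gamma_\alpha$; $B(X,Y)$ = $\Gamma$-equivariant maps $X\to Y$; $\mathcal E^{(p)}_\eta(f)=\frac12\sum_{x'}\eta(x_0\to x')d_Y(f(x_0),f(x'))^p$. $p$-uniformly convex: there is $c_Y>0$ with $d_Y(x,\gamma(t))^p\le(1-t)d_Y(x,y)^p+t\,d_Y(x,z)^p-c_Y^pt(1-t)d_Y(y,z)^p$ for all $x,y,z$,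 constant-speed geodesics $\gamma$ from $y$ to $z$, $t\in[0,1]$. Poincaré modulus $\Lambda^{(p)}_Z(\sigma)$: least $\Lambda$ with $\sum_{u,v}\nu(u)\nu(v)d_Z(f(u),f(v))^p\le\Lambda^p\sum_{u,v}\nu(u)\mu(u\to v)d_Z(f(u),f(v))^p$ for every finite reversible ergodic Markov chain $(V,\mu,\nu)$ of spectral gap $\ge\sigma$ and every $f:V\to Z$; $\Lambda^{(p)}_Y(\sigma,N)=\sup\{\Lambda^{(p)}_{Y'}(\sigma):Y'\subseteq Y,|Y'|\le N\}$. Property $(\mathrm P_p)$ of $\alpha$: there exist constants $a,b,K>0$ such that for every metric space $Y$ and isometric action of $\Gamma_\alpha$ on $Y$ there are arbitrarily large $N_i$ such that for every $f\in B(X,Y)$ there is an integer $m\in[a\log N_i,b\log N_i]$ with $\mathcal E^{(p)}_{\mu_X^{jm}}(f)\le K(\Lambda^{(p)}_Y(\sigma,N_i))^p\mathcal E^{(p)}_{\mu_X^j}(f)$. *)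

(* Defs.v *)
From Stdlib Require Lists.List.
From HB Require Import structures.
From mathcomp Require Import all_boot all_order all_algebra.
From mathcomp Require Import all_classical all_reals all_analysis.
Set Implicit Arguments. Unset Strict Implicit. Unset Printing Implicit Defensive.
Import Order.TTheory GRing.Theory Num.Theory.
Local Open Scope classical_set_scope.
Local Open Scope ring_scope.

Section Defs.
Variable R : realType.

Definition is_metric (Y : Type) (d : Y -> Y -> R) : Prop :=
  (forall x y, d x y = 0 <-> x = y) /\ (forall x y, d x y = d y x) /\
  (forall x y z, d x z <= d x y + d y z).

Definition is_cauchy (Y : Type) (d : Y -> Y -> R) (u : nat -> Y) : Prop :=
  forall eps : R, 0 < eps -> exists N : nat, forall m n : nat,
    (N <= m)%N -> (N <= n)%N -> d (u m) (u n) < eps.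

Definition converges_to (Y : Type) (d : Y -> Y -> R) (u : nat -> Y) (l : Y) : Prop :=
  forall eps : R, 0 < eps -> exists N : nat, forall n : nat, (N <= n)%N -> d (u n) l < eps.

Definition complete_metric (Y : Type) (d : Y -> Y -> R) : Prop :=
  forall u : nat -> Y, is_cauchy d u -> exists l, converges_to d u l.

(* constant-speed geodesic gamma : [0,1] -> Y from y to z (values off [0,1] irrelevant) *)
Definition const_speed_geodesic (Y : Type) (d : Y -> Y -> R) (y z : Y) (g : R -> Y) : Prop :=
  g 0 = y /\ g 1 = z /\
  forall s t : R, 0 <= s <= 1 -> 0 <= t <= 1 -> d (g s) (g t) = `|s - t| * d y z.

Definition geodesic_space (Y : Type) (d : Y -> Y -> R) : Prop :=
  forall y z : Y, exists g : R -> Y, const_speed_geodesic d y z g.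

Definition p_uniformly_convex (Y : Type) (d : Y -> Y -> R) (p : R) : Prop :=
  exists cY : R, 0 < cY /\
  forall (x y z : Y) (g : R -> Y), const_speed_geodesic d y z g ->
  forall t : R, 0 <= t <= 1 ->
    d x (g t) `^ p <= (1 - t) * d x y `^ p + t * d x z `^ p
                      - cY `^ p * t * (1 - t) * d y z `^ p.

Fixpoint kpow (V : finType) (mu : V -> V -> R) (t : nat) : V -> V -> R :=
  match t with
  | 0 => fun u v => (u == v)%:R
  | t'.+1 => fun u v => \sum_(w : V) mu u w * kpow mu t' w v
  end.

(* reversible (w.r.t. the stationary probability nu) and ergodic
   (= irreducible and aperiodic, i.e. some power of mu is entrywise positive) *)
Definition reversible_ergodic_chain (V : finType) (mu : V -> V -> R) (nu : V -> R) : Prop :=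
  (forall u v, 0 <= mu u v) /\ (forall u, \sum_(v : V) mu u v = 1) /\
  (forall u, 0 < nu u) /\ \sum_(u : V) nu u = 1 /\
  (forall u v, nu u * mu u v = nu v * mu v u) /\
  (exists t : nat, forall u v, 0 < kpow mu t u v).

(* spectral gap >= sigma: sigma * Var_nu(f) <= Dirichlet form E(f,f) for all f
   (variational definition of 1 - lambda_2; the factors 1/2 cancel) *)
Definition spectral_gap_ge (V : finType) (mu : V -> V -> R) (nu : V -> R) (sigma : R) : Prop :=
  forall f : V -> R,
    sigma * (\sum_(u : V) \sum_(v : V) nu u * nu v * (f u - f v) ^+ 2)
    <= \sum_(u : V) \sum_(v : V) nu u * mu u v * (f u - f v) ^+ 2.

Definition poincare_ineq (p sigma : R) (Z : Type) (dZ : Z -> Z -> R) (L : R) : Prop :=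
  forall (V : finType) (mu : V -> V -> R) (nu : V -> R),
    reversible_ergodic_chain mu nu -> spectral_gap_ge mu nu sigma ->
    forall f : V -> Z,
      \sum_(u : V) \sum_(v : V) nu u * nu v * dZ (f u) (f v) `^ p
      <= L `^ p * \sum_(u : V) \sum_(v : V) nu u * mu u v * dZ (f u) (f v) `^ p.

(* Lambda^{(p)}_Z(sigma) in [0, +oo] (+oo if no finite Lambda works) *)
Definition poincare_modulus (p sigma : R) (Z : Type) (dZ : Z -> Z -> R) : \bar R :=
  ereal_inf [set L%:E | L in [set L : R | 0 <= L /\ poincare_ineq p sigma dZ L]].

Definition subset_card_le (Y : Type) (N : nat) (A : set Y) : Prop :=
  exists s : seq Y, (size s <= N)%N /\ forall y, A y -> Stdlib.Lists.List.In y s.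

Definition poincare_modulus_N (p sigma : R) (Y : Type) (d : Y -> Y -> R) (N : nat) : \bar R :=
  ereal_sup [set poincare_modulus p sigma (fun a b : {y : Y | A y} => d (sval a) (sval b))
            | A in [set A : set Y | subset_card_le N A]].

End Defs.

(* (i, false) = a_i, (i, true) = a_i^{-1};  |S| = 2k *)
Definition gen (k : nat) : finType := ('I_k * bool)%type.
Definition ginv (k : nat) (s : gen k) : gen k := (s.1, ~~ s.2).
Definition word_inv (k : nat) (w : seq (gen k)) : seq (gen k) := rev (map (@ginv k) w).

Definition act_word (Y : Type) (k : nat) (rho : gen k -> Y -> Y) (w : seq (gen k)) (y : Y) : Y :=
  foldr rho y w.

(* isometric action of the free group Gamma, given by the images of the generators *)
Definition isometric_free_action (R : realType) (Y : Type) (d : Y -> Y -> R) (k : nat)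
  (rho : gen k -> Y -> Y) : Prop :=
  (forall s x y, d (rho s x) (rho s y) = d x y) /\ (forall s y, rho (ginv s) (rho s y) = y).

Definition is_cycle (T : finType) (e : rel T) (c : seq T) : Prop :=
  (3 <= size c)%N /\ uniq c /\ cycle e c.

Definition is_labeling (T : nat -> finType) (e : forall i, rel (T i)) (k j : nat)
  (alpha : forall i, T i -> T i -> j.-tuple (gen k)) : Prop :=
  forall i u v, e i u v -> (alpha i v u : seq (gen k)) = word_inv (alpha i u v).

Definition cycle_word (T : finType) (k j : nat) (a : T -> T -> j.-tuple (gen k)) (c : seq T)
  : seq (gen k) :=
  flatten [seq (a x.1 x.2 : seq (gen k)) | x <- zip c (rot 1 c)].

(* isometric action of Gamma_alpha = Gamma / <<cycle relators>> *)
Definition alpha_action (R : realType) (Y : Type) (d : Y -> Y -> R)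
  (T : nat -> finType) (e : forall i, rel (T i)) (k j : nat)
  (alpha : forall i, T i -> T i -> j.-tuple (gen k)) (rho : gen k -> Y -> Y) : Prop :=
  isometric_free_action d rho /\
  forall i (c : seq (T i)), is_cycle (e i) c ->
    forall y, act_word rho (cycle_word (alpha i) c) y = y.

(* E^{(p)}_{mu_X^n}(f) for the equivariant f in B(X,Y) with f(x0) = y, x0 = identity:
   1/2 sum_{x'} mu_X^n(x0 -> x') d(f x0, f x')^p, expanding mu_X^n over the (2k)^n words *)
Definition energy (R : realType) (p : R) (Y : Type) (d : Y -> Y -> R) (k : nat)
  (rho : gen k -> Y -> Y) (n : nat) (y : Y) : R :=
  2^-1 * \sum_(w : n.-tuple (gen k)) ((2 * k)%:R ^- n) * d y (act_word rho w y) `^ p.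

Definition property_P (R : realType) (p sigma : R)
  (T : nat -> finType) (e : forall i, rel (T i)) (k j : nat)
  (alpha : forall i, T i -> T i -> j.-tuple (gen k)) : Prop :=
  exists a b K : R, 0 < a /\ 0 < b /\ 0 < K /\
  forall (Y : Type) (d : Y -> Y -> R), is_metric d ->
  forall rho : gen k -> Y -> Y, alpha_action d e alpha rho ->
  forall M : nat, exists i : nat, (M <= #|T i|)%N /\
    forall y : Y, exists m : nat,
      a * ln (#|T i|%:R) <= m%:R <= b * ln (#|T i|%:R) /\
      ((energy p d rho (j * m) y)%:E
        <= K%:E * (poweR (poincare_modulus_N p sigma d #|T i|) p) * (energy p d rho j y)%:E)%E.

Definition deg (T : finType) (e : rel T) (u : T) : nat := #|[set v | e u v]|.

Definition srw_mu (R : realType) (T : finType) (e : rel T) (u v : T) : R :=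
  (e u v)%:R / (deg e u)%:R.
Definition srw_nu (R : realType) (T : finType) (e : rel T) (u : T) : R :=
  (deg e u)%:R / (\sum_(w : T) deg e w)%:R.

Definition graph_family (R : realType) (T : nat -> finType) (e : forall i, rel (T i))
  (dg : nat) (cg sigma : R) : Prop :=
  (forall i, symmetric (e i) /\ irreflexive (e i)) /\
  (forall i (u v : T i), connect (e i) u v) /\
  (forall i, ~ exists col : T i -> bool, forall u v, e i u v -> col u != col v) /\
  (forall M : nat, exists i0, forall i, (i0 <= i)%N -> (M <= #|T i|)%N) /\
  (forall i (u : T i), (3 <= deg (e i) u <= dg)%N) /\
  (forall i, spectral_gap_ge (@srw_mu R _ (e i)) (@srw_nu R _ (e i)) sigma) /\
  (forall i (c : seq (T i)), is_cycle (e i) c -> cg * ln (#|T i|%:R) <= (size c)%:R).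

(* Main.v *)
(** Write [E_n(y)] for the energy of the orbit map of [y] under the [n]-step walk, and let
    [P] be the [j]-step walk. Let [z] be an approximate [p]-barycenter of the law of [W y]
    after [m] steps of [P]. Averaging the uniform convexity inequality of the [p]-th moment
    at [z] over the translates of [z] by words of length [j] bounds [E_j(z)] by the growth of
    this moment from time [m] to time [m + 1]. Since [j] is even, [P] is lazy, so it is a
    binomial mixture of powers of a second walk, and the Chernoff bound shows that one more
    step increases a moment at most by the factor [1 + O(sqrt (ln m / m))], up to negligible
    tails. With property [(P_p)] this gives
      [E_j(z) <= O(sqrt (ln ln N / ln N) (1 + Lambda^p) + theta) E_j(y)]
    for any prescribed [theta > 0], so for one fixed large [N] the energy is contracted, and
    [d(y, z)^p] is at most a constant times [E_j(y)]. Iterating yields a point fixed by all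
    words of length [j], hence by all even words; the midpoint of its orbit is fixed. *)

Require Import Defs.
From HB Require Import structures.
From mathcomp Require Import all_boot all_order all_algebra.
From mathcomp Require Import all_classical all_reals all_analysis.
From mathcomp Require Import ring lra.
Set Implicit Arguments. Unset Strict Implicit. Unset Printing Implicit Defensive.
Import Order.TTheory GRing.Theory Num.Theory.
Local Open Scope classical_set_scope.
Local Open Scope ring_scope.

(** * Iterated weighted averaging operators *)

Definition avg (R : realType) (Y : Type) (I : finType) (c : I -> R) (g : I -> Y -> Y)
  (h : Y -> R) (y : Y) : R := \sum_(i : I) c i * h (g i y).

Section AverageOperators.
Variables (R : realType) (Y : Type) (I : finType) (c : I -> R) (g : I -> Y -> Y).
Local Notation A := (avg c g).

Lemma iter_avg_lin (n : nat) (a b : R) (h1 h2 : Y -> R) (y : Y) :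
  iter n A (fun v => a * h1 v + b * h2 v) y = a * iter n A h1 y + b * iter n A h2 y.
Proof.
elim: n y => [//|n IHn] y; rewrite !iterS /avg !mulr_sumr -big_split /=.
by apply: eq_bigr => i _; rewrite IHn; ring.
Qed.

Lemma iter_avg_sum (n : nat) (J : finType) (b : J -> R) (h : J -> Y -> R) (y : Y) :
  iter n A (fun v => \sum_(l : J) b l * h l v) y = \sum_(l : J) b l * iter n A (h l) y.
Proof.
elim: n y => [//|n IHn] y; rewrite iterS /avg.
under [LHS]eq_bigr do rewrite IHn mulr_sumr.
rewrite exchange_big /=; apply: eq_bigr => l _; rewrite mulr_sumr.
by apply: eq_bigr => i _; rewrite mulrCA.
Qed.

Lemma iter_avg_cst (n : nat) (x : R) (y : Y) :
  iter n A (fun=> x) y = (\sum_i c i) ^+ n * x.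
Proof.
elim: n y => [|n IHn] y; first by rewrite expr0 mul1r.
rewrite iterS /avg; under eq_bigr do rewrite IHn.
by rewrite -mulr_suml exprS mulrA.
Qed.

Hypothesis c_ge0 : forall i, 0 <= c i.

Lemma iter_avg_le (n : nat) (h1 h2 : Y -> R) (y : Y) :
  (forall v, h1 v <= h2 v) -> iter n A h1 y <= iter n A h2 y.
Proof.
move=> le_h; elim: n y => [//|n IHn] y; rewrite !iterS /avg.
by apply: ler_sum => i _; rewrite ler_wpM2l.
Qed.

Lemma iter_avg_ge0 (n : nat) (h : Y -> R) (y : Y) :
  (forall v, 0 <= h v) -> 0 <= iter n A h y.
Proof.
by move=> h_ge0; rewrite -[0](mulr0 ((\sum_i c i) ^+ n)) -(iter_avg_cst n 0 y) iter_avg_le.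
Qed.

(** The binomial theorem for a scalar plus [A], by Pascal's rule. It expands a lazy walk into powers
    of its non-lazy part. *)
Lemma iter_avg_shift (n : nat) (al : R) (P : (Y -> R) -> Y -> R) (h : Y -> R) (y : Y) :
  (forall h' v, P h' v = al * h' v + A h' v) ->
  iter n P h y = \sum_(i < n.+1) 'C(n, i)%:R * al ^+ (n - i) * iter i A h y.
Proof.
move=> PE; elim: n h => [|n IHn] h.
  by rewrite big_ord_recl big_ord0 bin0 subnn expr0 !mul1r addr0.
rewrite iterSr IHn.
have -> : P h = (fun v => al * h v + 1 * A h v) by apply/funext => v; rewrite PE mul1r.
under eq_bigr do rewrite iter_avg_lin mul1r -iterSr mulrDr.
rewrite big_split /= [RHS]big_ord_recl bin0 subn0.
under [in RHS]eq_bigr => i _ do rewrite lift0 binS natrD subSS !mulrDl.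
rewrite big_split /= addrA; congr (_ + _).
rewrite [in RHS]big_ord_recr /= bin_small // !mul0r addr0.
rewrite big_ord_recl /= bin0 subn0; congr (_ + _); first by rewrite exprS; ring.
apply: eq_bigr => i _; rewrite /bump leq0n add1n.
have -> : (n - i = (n - i.+1).+1)%N by rewrite subnSK.
by rewrite exprS; ring.
Qed.

End AverageOperators.

(** * Exponential and binomial tail estimates *)

Lemma expR_le_quadratic (R : realType) (x : R) : x <= 2^-1 -> expR x <= 1 + x + 2 * x ^+ 2.
Proof.
move=> x_le.
have x1 : 0 < 1 - x by lra.
have := expR_ge1Dx (- x); rewrite expRN => h.
have ex := expR_gt0 x.
have h1 : (1 - x) * expR x <= 1 by rewrite -ler_pdivlMr // mul1r.
rewrite -(ler_pM2l x1); apply: (le_trans h1).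
have -> : (1 - x) * (1 + x + 2 * x ^+ 2) = 1 + x ^+ 2 * (1 - 2 * x) by ring.
by rewrite lerDl mulr_ge0 ?sqr_ge0 //; lra.
Qed.

(** Moment generating function of a centered Bernoulli variable: in the quadratic bounds the linear
    terms cancel and the remainder is [2 * al * be * la ^+ 2], with [al * be] at most 1/4. *)
Lemma bernoulli_mgf_le (R : realType) (al be la : R) :
  0 < al -> 0 < be -> al + be = 1 -> 0 <= la <= 2^-1 ->
  al * expR (- (la * be)) + be * expR (la * al) <= expR (la ^+ 2).
Proof.
move=> al0 be0 ab /andP[la0 la1].
have bE : be = 1 - al by lra.
have h1 : expR (- (la * be)) <= 1 + - (la * be) + 2 * (- (la * be)) ^+ 2.
  by apply: expR_le_quadratic; nra.
have h2 : expR (la * al) <= 1 + (la * al) + 2 * (la * al) ^+ 2.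
  by apply: expR_le_quadratic; nra.
apply: (@le_trans _ _ (1 + la ^+ 2)); last exact: expR_ge1Dx.
rewrite -(ler_pM2l al0) in h1; rewrite -(ler_pM2l be0) in h2.
apply: (le_trans (lerD h1 h2)).
have -> : al * (1 + - (la * be) + 2 * (- (la * be)) ^+ 2)
   + be * (1 + la * al + 2 * (la * al) ^+ 2) = 1 + la ^+ 2 * (2 * (al * be)).
  by rewrite bE; ring.
by rewrite lerD2l ler_piMr ?sqr_ge0 // bE; nra.
Qed.

(* Passing from m to m + 1 trials multiplies the i-th binomial weight by
   al (m + 1) / (m + 1 - i), which exceeds 1 + eps only for i in the upper tail;
   there the Chernoff bound with parameter al eps / 4 takes over. *)
Lemma binomial_average_step (R : realType) (al be eps H : R) (m : nat) (a : nat -> R) :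
  0 < al -> 0 < be -> al + be = 1 -> 0 < eps <= 1 ->
  (forall i, 0 <= a i) -> (forall i, (i <= m.+1)%N -> a i <= be ^+ i * H) ->
  \sum_(i < m.+2) 'C(m.+1, i)%:R * al ^+ (m.+1 - i) * a i <=
  (1 + eps) * (\sum_(i < m.+1) 'C(m, i)%:R * al ^+ (m - i) * a i)
  + H * expR (- (m.+1%:R * (al ^+ 2 * eps ^+ 2 / 16))).
Proof.
move=> al0 be0 ab /andP[eps0 eps1] a0 aH.
set la := al * eps / 4.
have H0 : 0 <= H by have := aH 0%N isT; rewrite expr0 mul1r; apply: le_trans.
(* Exponential weight: at least 1 once [i] exceeds its mean by [m.+1 * al * eps / 2], which is
   forced in the case [bad] below. *)
pose t i : R := expR (la * (i%:R - m.+1%:R * be - m.+1%:R * al * eps / 2)).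
have -> : (1 + eps) * (\sum_(i < m.+1) 'C(m, i)%:R * al ^+ (m - i) * a i) =
    \sum_(i < m.+2) (1 + eps) * ('C(m, i)%:R * al ^+ (m - i) * a i).
  by rewrite [RHS]big_ord_recr /= bin_small // !mul0r mulr0 addr0 mulr_sumr.
have le_term (i : 'I_m.+2) : 'C(m.+1, i)%:R * al ^+ (m.+1 - i) * a i <=
    (1 + eps) * ('C(m, i)%:R * al ^+ (m - i) * a i)
    + 'C(m.+1, i)%:R * al ^+ (m.+1 - i) * (be ^+ i * H) * t i.
  have im : (i <= m.+1)%N by rewrite -ltnS.
  have good0 : 0 <= (1 + eps) * ('C(m, i)%:R * al ^+ (m - i) * a i).
    by rewrite !mulr_ge0 ?ler0n ?exprn_ge0 ?(ltW al0) //; lra.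
  have bad0 : 0 <= 'C(m.+1, i)%:R * al ^+ (m.+1 - i) * (be ^+ i * H) * t i.
    by rewrite !mulr_ge0 ?ler0n ?exprn_ge0 ?expR_ge0 ?(ltW al0) ?(ltW be0) ?(ltW eps0).
  have [good|bad] := leP (al * m.+1%:R) ((1 + eps) * (m.+1 - i)%:R).
    apply: (@le_trans _ _ ((1 + eps) * ('C(m, i)%:R * al ^+ (m - i) * a i)));
      last by rewrite lerDl.
    have i_m : (i <= m)%N.
      rewrite leqNgt; apply/negP => mi.
      have e : nat_of_ord i = m.+1 by apply/eqP; rewrite eqn_leq im.
      by move: good; rewrite e subnn mulr0 pmulr_rle0 // lern0.
    have [r0 rE] : 0 < (m.+1 - i)%:R :> R /\ (m.+1 - i)%:R * 'C(m.+1, i)%:R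
          = m.+1%:R * 'C(m, i)%:R :> R.
      by rewrite ltr0n subn_gt0 ltnS i_m -!natrM -mul_bin_down.
    rewrite subSn // exprS -(ler_pM2l r0).
    have -> : (m.+1 - i)%:R * ('C(m.+1, i)%:R * (al * al ^+ (m - i)) * a i)
        = al * m.+1%:R * ('C(m, i)%:R * al ^+ (m - i) * a i).
      by rewrite !mulrA rE; ring.
    rewrite [leRHS]mulrCA [leRHS]mulrA ler_wpM2r //.
    by rewrite !mulr_ge0 ?ler0n ?exprn_ge0 ?(ltW al0) ?(ltW be0) ?(ltW eps0).
  apply: (@le_trans _ _ ('C(m.+1, i)%:R * al ^+ (m.+1 - i) * (be ^+ i * H) * t i));
    last by rewrite lerDr.
  apply: (@le_trans _ _ ('C(m.+1, i)%:R * al ^+ (m.+1 - i) * (be ^+ i * H))).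
    by rewrite ler_wpM2l ?aH // mulr_ge0 ?ler0n ?exprn_ge0 ?(ltW al0) ?(ltW be0) ?(ltW eps0).
  rewrite ler_peMr ?mulr_ge0 ?ler0n ?exprn_ge0 ?(ltW al0) ?(ltW be0) ?(ltW eps0) //.
  rewrite -expR0 ler_expR mulr_ge0 //; first by rewrite /la !mulr_ge0 ?(ltW al0) ?(ltW be0) ?(ltW eps0).
  rewrite natrB // in bad.
  set n : R := m.+1%:R in bad *; have n0 : 0 < n by rewrite ltr0n.
  set x : R := i%:R in bad *.
  have bE : be = 1 - al by lra.
  have nx : 0 <= n - x by rewrite subr_ge0 ler_nat.
  (* [(1 - eps / 2) * (1 + eps)] is at least 1 because [eps] is at most 1. *)
  have h1 : n - x <= (1 - eps / 2) * (1 + eps) * (n - x).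
    by rewrite ler_peMl //; nra.
  have h2 : (1 - eps / 2) * ((1 + eps) * (n - x)) <= (1 - eps / 2) * (al * n).
    by rewrite ler_wpM2l ?(ltW bad) //; lra.
  by rewrite bE; nra.
apply: (le_trans (ler_sum _ (fun i _ => le_term i))).
rewrite big_split /= lerD2l.
(* The exponential splits over failures and successes, so the weighted tail sums to an [m.+1]-st
   power of the Bernoulli generating function. *)
have tE (i : 'I_m.+2) : 'C(m.+1, i)%:R * al ^+ (m.+1 - i) * (be ^+ i * H) * t i =
  H * expR (- (la * (m.+1%:R * al * eps / 2))) *
  (((al * expR (- (la * be))) ^+ (m.+1 - i) * (be * expR (la * al)) ^+ i)
     *+ 'C(m.+1, i)).
  have im : (i <= m.+1)%N by rewrite -ltnS.
  have -> : t i = expR (- (la * (m.+1%:R * al * eps / 2))) *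
     (expR (- (la * be)) ^+ (m.+1 - i) * expR (la * al) ^+ i).
    rewrite -!expRM_natl -!expRD /t; congr expR; rewrite natrB //.
    have -> : be = 1 - al by lra.
    by ring.
  by rewrite !exprMn -mulr_natl; ring.
rewrite (eq_bigr _ (fun i _ => tE i)) -mulr_sumr -exprDn -mulrA ler_wpM2l //.
have := @bernoulli_mgf_le R al be la al0 be0 ab.
have -> : 0 <= la <= 2^-1.
  by rewrite /la !mulr_ge0 ?(ltW al0) ?(ltW be0) ?(ltW eps0) //=; nra.
move=> /(_ isT) mgf.
apply: (@le_trans _ _ (expR (- (la * (m.+1%:R * al * eps / 2))) * expR (la ^+ 2) ^+ m.+1)).
  rewrite ler_wpM2l ?expR_ge0 // lerXn2r ?nnegrE ?expR_ge0 //.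
  by rewrite addr_ge0 // mulr_ge0 ?expR_ge0 ?(ltW al0) ?(ltW be0).
by rewrite -expRM_natl -expRD ler_expR /la le_eqVlt; apply/orP; left; apply/eqP; field.
Qed.

(** * Words acting by isometries, and averages over words *)

Lemma ginvK (k : nat) : involutive (@ginv k).
Proof. by case=> i b; rewrite /ginv /= negbK. Qed.

Lemma act_word_cat (Y : Type) (k : nat) (rho : gen k -> Y -> Y) (w1 w2 : seq (gen k)) (y : Y) :
  act_word rho (w1 ++ w2) y = act_word rho w1 (act_word rho w2 y).
Proof. by rewrite /act_word foldr_cat. Qed.

Lemma metric_ge0 (R : realType) (Y : Type) (d : Y -> Y -> R) (x y : Y) :
  is_metric d -> 0 <= d x y.
Proof.
move=> [d0 [dC dT]]; have := dT x y x; rewrite [d y x]dC.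
by have -> : d x x = 0 by [apply/d0]; lra.
Qed.

Section FreeAction.
Variables (R : realType) (Y : Type) (d : Y -> Y -> R) (k : nat) (rho : gen k -> Y -> Y).
Hypothesis rho_iso : isometric_free_action d rho.

Lemma act_word_isometry (w : seq (gen k)) (x y : Y) :
  d (act_word rho w x) (act_word rho w y) = d x y.
Proof. by elim: w => [//|s w IHw] /=; rewrite rho_iso.1. Qed.

Lemma rho_ginv (s : gen k) (y : Y) : rho s (rho (ginv s) y) = y.
Proof. by rewrite -{1}(ginvK s) rho_iso.2. Qed.

Lemma act_word_invr (w : seq (gen k)) (y : Y) :
  act_word rho w (act_word rho (word_inv w) y) = y.
Proof.
elim: w y => [//|s w IHw] y.
by rewrite /word_inv map_cons rev_cons -cats1 act_word_cat /= IHw rho_ginv.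
Qed.

Lemma act_word_adjoint (w : seq (gen k)) (x y : Y) :
  d x (act_word rho w y) = d (act_word rho (word_inv w) x) y.
Proof. by rewrite -{1}(act_word_invr w x) act_word_isometry. Qed.

(** Repeating a pair [s], [ginv s] works in every even length; this is the source of the laziness of
    the [j]-step walk. *)
Lemma trivial_even_word (n : nat) : (0 < k)%N ->
  exists2 w : seq (gen k), size w = n.*2 & forall y, act_word rho w y = y.
Proof.
move=> k0; pose s : gen k := (Ordinal k0, false).
elim: n => [|n [w sw wy]]; first by exists [::].
exists (s :: ginv s :: w); first by rewrite /= sw doubleS.
by move=> y /=; rewrite wy rho_ginv.
Qed.

Lemma trivial_tuple_word (j : nat) : (0 < k)%N -> ~~ odd j ->
  exists w : j.-tuple (gen k), forall y, act_word rho w y = y.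
Proof.
move=> k0 j_even; have [w sw wy] := trivial_even_word j./2 k0.
have {}sw : size w == j by rewrite sw even_halfK.
by exists (Tuple sw).
Qed.

End FreeAction.

Lemma big_tuple_cons (R : realType) (T : finType) (n : nat) (F : n.+1.-tuple T -> R) :
  \sum_(w : n.+1.-tuple T) F w = \sum_(a : T) \sum_(w : n.-tuple T) F [tuple of a :: w].
Proof.
rewrite pair_big /=.
rewrite (reindex (fun x : T * n.-tuple T => [tuple of x.1 :: x.2])) //=.
exists (fun w : n.+1.-tuple T => (thead w, [tuple of behead w])) => [[a w]|w] _ /=.
  by congr pair; apply: val_inj.
by rewrite [RHS](tuple_eta w).
Qed.

Lemma big_tuple_nil (R : realType) (T : finType) (F : 0.-tuple T -> R) :
  \sum_(w : 0.-tuple T) F w = F [tuple].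
Proof.
rewrite (big_pred1 [tuple]) // => w.
by apply/esym/eqP/val_inj; rewrite /= (size0nil (size_tuple w)).
Qed.

Section WordAverages.
Variables (R : realType) (Y : Type) (k : nat) (rho : gen k -> Y -> Y).

Definition wavg (n : nat) : (Y -> R) -> Y -> R :=
  avg (fun _ : n.-tuple (gen k) => (2 * k)%:R ^- n) (fun w => act_word rho w).

Lemma wavgE (n : nat) :
  wavg n = iter n (avg (fun _ : gen k => (2 * k)%:R ^-1) rho).
Proof.
apply/funext => h; apply/funext => y; elim: n h => [|n IHn] h.
  by rewrite /wavg /avg big_tuple_nil expr0 invr1 mul1r.
rewrite iterSr -IHn /wavg /avg big_tuple_cons exchange_big /=.
apply: eq_bigr => w _; rewrite mulr_sumr; apply: eq_bigr => s _.
by rewrite exprS invfM mulrA [_ ^-1 * _]mulrC.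
Qed.

Lemma wavgM (n m : nat) : wavg (n * m) = iter m (wavg n).
Proof. by apply/funext => h; rewrite mulnC !wavgE iterM. Qed.

Lemma word_weight_sum (n : nat) : (0 < k)%N ->
  \sum_(w : n.-tuple (gen k)) (2 * k)%:R ^- n = 1 :> R.
Proof.
move=> k0; rewrite sumr_const card_tuple /gen card_prod card_ord card_bool.
rewrite -[LHS]mulr_natr natrX mulnC mulVf // expf_neq0 // pnatr_eq0.
by rewrite muln_eq0 negb_or -lt0n k0.
Qed.

End WordAverages.

Lemma energyE (R : realType) (p : R) (Y : Type) (d : Y -> Y -> R) (k : nat)
    (rho : gen k -> Y -> Y) (n : nat) (y : Y) :
  energy p d rho n y = 2^-1 * wavg rho n (fun v => d y v `^ p) y.
Proof. by []. Qed.

Lemma energy_ge0 (R : realType) (p : R) (Y : Type) (d : Y -> Y -> R) (k : nat)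
    (rho : gen k -> Y -> Y) (n : nat) (y : Y) : 0 <= energy p d rho n y.
Proof.
rewrite mulr_ge0 // sumr_ge0 // => w _.
by rewrite mulr_ge0 ?powR_ge0 // invr_ge0 exprn_ge0.
Qed.

(** A single word has weight [(2 * k)%:R ^- n / 2] in the energy, and all other terms are
    nonnegative. *)
Lemma displacement_le_energy (R : realType) (p : R) (Y : Type) (d : Y -> Y -> R) (k : nat)
    (rho : gen k -> Y -> Y) (n : nat) (y : Y) (w : n.-tuple (gen k)) : (0 < k)%N ->
  d y (act_word rho w y) `^ p <= 2 * (2 * k)%:R ^+ n * energy p d rho n y.
Proof.
move=> k0.
have q0 : 0 < (2 * k)%:R ^+ n :> R by rewrite exprn_gt0 // ltr0n muln_gt0.
rewrite -(ler_pdivrMl _ _ (mulr_gt0 (ltr0n _ 2) q0)).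
rewrite invfM -mulrA ler_pM2l // (bigD1 w) //= lerDl sumr_ge0 // => w' _.
by rewrite mulr_ge0 ?powR_ge0 // invr_ge0 ltW.
Qed.

(** * Midpoint convexity and approximate minimizers *)

Lemma ler_powR2 (R : realType) (p x y : R) : 0 <= p -> 0 <= x -> x <= y -> x `^ p <= y `^ p.
Proof.
by move=> p0 x0 xy; apply: ge0_ler_powR; rewrite ?nnegrE //; apply: le_trans xy.
Qed.

(** Uniform convexity at [t = 1/2], with [c] in the role of [cY ^ p / 4]. One [q] serves all [x], so
    the inequality can be integrated over [x]. *)
Definition midpoint_convex (R : realType) (Y : Type) (d : Y -> Y -> R) (p c : R) : Prop :=
  forall y z : Y, exists q : Y, forall x : Y,
    d x q `^ p <= (d x y `^ p + d x z `^ p) / 2 - c * d y z `^ p.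

Lemma p_uniformly_convex_midpoint (R : realType) (Y : Type) (d : Y -> Y -> R) (p : R) :
  geodesic_space d -> p_uniformly_convex d p ->
  exists2 c : R, 0 < c & midpoint_convex d p c.
Proof.
move=> geo [cY [cY0 conv]]; exists (cY `^ p / 4); first by rewrite divr_gt0 ?powR_gt0.
move=> y z; have [g yzg] := geo y z; exists (g 2^-1) => x.
have h : 0 <= (2^-1 : R) <= 1 by apply/andP; split; lra.
apply: (le_trans (conv x y z g yzg 2^-1 h)).
by rewrite le_eqVlt; apply/orP; left; apply/eqP; field.
Qed.

Lemma approx_minimizer (R : realType) (Y : Type) (F : Y -> R) (delta : R) :
  inhabited Y -> (forall y, 0 <= F y) -> 0 < delta ->
  exists z0, forall z, F z0 <= F z + delta.
Proof.
move=> [y0] F0 d0.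
have hi : has_inf (range F).
  by split; [exists (F y0), y0 | exists 0 => _ [y _ <-]].
have [_ [z0 _ <-] hz0] := inf_adherent d0 hi.
exists z0 => z; apply: (le_trans (ltW hz0)); rewrite lerD2r.
by apply: ge_inf; [exact: hi.2 | exists z].
Qed.

(** * Moments of the walk and their growth in one step *)

Section HeatStep.
Variables (R : realType) (Y : Type) (d : Y -> Y -> R) (p c : R) (k j : nat).
Variable rho : gen k -> Y -> Y.
Hypotheses (p_ge0 : 0 <= p) (d_metric : is_metric d) (d_convex : midpoint_convex d p c).
Hypotheses (k_gt0 : (0 < k)%N) (j_gt0 : (0 < j)%N) (j_even : ~~ odd j).
Hypothesis rho_iso : isometric_free_action d rho.

Definition moment (m : nat) (y z : Y) : R := iter m (wavg rho j) (fun v => d z v `^ p) y.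

Let weight_ge0 (w : j.-tuple (gen k)) : 0 <= (2 * k)%:R ^- j :> R.
Proof. by rewrite invr_ge0 exprn_ge0. Qed.

Lemma moment_ge0 (m : nat) (y z : Y) : 0 <= moment m y z.
Proof. by apply: iter_avg_ge0 => // v; exact: powR_ge0. Qed.

Lemma moment_diag (m : nat) (y : Y) : moment m y y = 2 * energy p d rho (j * m) y.
Proof. by rewrite energyE wavgM mulrA mulfV // mul1r. Qed.

(** The convexity inequality for the midpoint of [z] and [z0] is integrated over the law of the
    walk, which has total mass one. *)
Lemma moment_midpoint (m : nat) (y z z0 : Y) : exists q,
  moment m y q <= (moment m y z + moment m y z0) / 2 - c * d z z0 `^ p.
Proof.
have [_ [dC _]] := d_metric; have [q hq] := d_convex z z0; exists q.
pose h1 (v : Y) : R := 2^-1 * d z v `^ p + 2^-1 * d z0 v `^ p.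
apply: (@le_trans _ _ (iter m (wavg rho j) (fun v => 1 * h1 v + (-1) * (c * d z z0 `^ p)) y)).
  apply: iter_avg_le => // v; apply: le_trans (_ : d v q `^ p <= _); first by rewrite dC.
  apply: (le_trans (hq v)); rewrite /h1 (dC v z) (dC v z0).
  by rewrite le_eqVlt; apply/orP; left; apply/eqP; field.
rewrite iter_avg_lin /h1 iter_avg_lin iter_avg_cst word_weight_sum // expr1n.
by rewrite le_eqVlt; apply/orP; left; apply/eqP; rewrite /moment; field.
Qed.

(** The outermost [j] letters of the word are moved onto [z] by isometry. *)
Lemma momentS (m : nat) (y z : Y) :
  moment m.+1 y z = \sum_(w : j.-tuple (gen k))
    (2 * k)%:R ^- j * moment m y (act_word rho (word_inv w) z).
Proof.
rewrite /moment iterSr -iter_avg_sum; congr (iter m _ _ y).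
apply/funext => v; apply: eq_bigr => w _.
by rewrite (act_word_adjoint rho_iso).
Qed.

(* An approximate p-barycenter z0 of the walk after m steps. Averaging its convexity
   inequality over the translates of z0 bounds the energy of z0 by the increment of the
   moment from time m to time m + 1. *)
Lemma approx_barycenter (m : nat) (y : Y) (delta : R) : 0 < delta ->
  exists z0, [/\ moment m y z0 <= moment m y y + delta,
    2 * c * d y z0 `^ p <= moment m y y + 2 * delta &
    4 * c * energy p d rho j z0 <= moment m.+1 y z0 - moment m y z0 + 2 * delta].
Proof.
move=> delta0.
have [z0 hz0] := @approx_minimizer R Y (moment m y) delta (inhabits y) (moment_ge0 m y) delta0.
(* The midpoint of [z] and [z0] cannot beat the near-minimum at [z0], so the moment grows with the
   distance from [z0]. *)
have hc z : 2 * c * d z z0 `^ p <= moment m y z - moment m y z0 + 2 * delta.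
  by have [q hq] := moment_midpoint m y z z0; have := hz0 q; lra.
exists z0; split; first exact: hz0.
  by have := hc y; have := moment_ge0 m y z0; lra.
have [_ [dC _]] := d_metric.
have -> : 4 * c * energy p d rho j z0 = \sum_(w : j.-tuple (gen k))
    (2 * k)%:R ^- j * (2 * c * d (act_word rho (word_inv w) z0) z0 `^ p).
  rewrite energyE /wavg /avg !mulr_sumr; apply: eq_bigr => w _.
  by rewrite (act_word_adjoint rho_iso); move: (_ ^- j) => q; field.
have -> : moment m.+1 y z0 - moment m y z0 + 2 * delta = \sum_(w : j.-tuple (gen k))
    (2 * k)%:R ^- j * (moment m y (act_word rho (word_inv w) z0) - moment m y z0 + 2 * delta).
  under eq_bigr do rewrite -addrA mulrDr.
  by rewrite big_split /= -momentS -mulr_suml word_weight_sum // mul1r addrA.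
by apply: ler_sum => w _; rewrite ler_wpM2l.
Qed.

(** One step adds at most [D] to the distance from [y], since [d y (w u) <= d y (w y) + d y u]. The
    weights may have total mass below one, as for the walk without its lazy part. *)
Lemma iter_avg_growth (b : j.-tuple (gen k) -> R) (i : nat) (y v : Y) (C d0 D : R) (h : Y -> R) :
  (forall w, 0 <= b w) -> 0 <= C -> 0 <= d0 -> 0 <= D ->
  (forall w : j.-tuple (gen k), d y (act_word rho w y) <= D) ->
  (forall u, h u <= C * (d0 + d y u) `^ p) ->
  iter i (avg b (fun w => act_word rho w)) h v <=
    (\sum_w b w) ^+ i * C * (d0 + i%:R * D + d y v) `^ p.
Proof.
move=> b0 C0 d00 D0 hD; have [_ [dC dT]] := d_metric.
elim: i C d0 C0 d00 h => [|i IHi] C d0 C0 d00 h hh.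
  by rewrite expr0 mul1r mul0r addr0.
rewrite iterSr; apply: (le_trans (IHi ((\sum_w b w) * C) (d0 + D) _ _ _ _)).
- by rewrite mulr_ge0 // sumr_ge0.
- by rewrite addr_ge0.
- move=> u; rewrite /avg -mulrA mulr_suml; apply: ler_sum => w _.
  rewrite ler_wpM2l //; apply: (le_trans (hh _)); rewrite ler_wpM2l //.
  have tr := dT y (act_word rho w y) (act_word rho w u).
  rewrite (act_word_isometry rho_iso) in tr.
  have := metric_ge0 y (act_word rho w u) d_metric.
  by have := hD w; move=> h1 h2; apply: ler_powR2 => //; lra.
- rewrite exprSr mulrA le_eqVlt; apply/orP; left; apply/eqP; congr (_ * _ `^ _).
  by rewrite -natr1; ring.
Qed.

(* The walk of step wavg j is lazy with holding probability at least (2k)^-j, since j is even. *)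
Lemma moment_step (m : nat) (y z : Y) (d0 D eps : R) :
  d z y <= d0 -> 0 <= D -> 0 < eps <= 1 ->
  (forall w : j.-tuple (gen k), d y (act_word rho w y) <= D) ->
  moment m.+1 y z <= (1 + eps) * moment m y z
    + (d0 + m.+1%:R * D) `^ p
      * expR (- (m.+1%:R * (((2 * k)%:R ^- j) ^+ 2 * eps ^+ 2 / 16))).
Proof.
move=> hd0 D0 eps01 hD.
have [w0 hw0] := trivial_tuple_word rho_iso k_gt0 j_even.
have [dxy0 [dC dT]] := d_metric.
set al : R := (2 * k)%:R ^- j.
pose b w : R := if w == w0 then 0 else al.
have q1 : 1 < (2 * k)%:R ^+ j :> R.
  by rewrite exprn_egt1 -?lt0n // ltr1n (leq_trans _ (leq_pmulr 2 k_gt0)).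
have al0 : 0 < al by rewrite invr_gt0 (lt_trans ltr01).
have al1 : al < 1 by rewrite invf_lt1 // (lt_trans ltr01).
have b0 w : 0 <= b w by rewrite /b; case: ifP => // _; exact: ltW.
have PE h v : wavg rho j h v = al * h v + avg b (fun w => act_word rho w) h v.
  rewrite /wavg /avg (bigD1 w0) //= hw0; congr (_ + _).
  rewrite [RHS](bigD1 w0) //= /b eqxx mul0r add0r.
  by apply: eq_bigr => w /negbTE ->.
have bsum : \sum_w b w = 1 - al.
  have := word_weight_sum R j k_gt0; rewrite (bigD1 w0) //= -/al => e1.
  rewrite (bigD1 w0) //= /b eqxx add0r -e1 [al + _]addrC addrK.
  by apply: eq_bigr => w /negbTE ->.
rewrite /moment !(iter_avg_shift _ _ _ PE).
apply: (@binomial_average_step R al (1 - al) eps _ m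
  (fun i => iter i (avg b (fun w => act_word rho w)) (fun v => d z v `^ p) y)) => //.
- by rewrite subr_gt0.
- by rewrite addrC subrK.
- by move=> i; apply: iter_avg_ge0 => // v; exact: powR_ge0.
have d00 : 0 <= d0 := le_trans (metric_ge0 z y d_metric) hd0.
move=> i im.
have := @iter_avg_growth b i y y 1 d0 D (fun v => d z v `^ p) b0 ler01 d00 D0 hD.
have -> : d y y = 0 by apply/dxy0.
rewrite bsum mulr1 addr0 => H; apply: (le_trans (H _)).
  move=> u; rewrite mul1r; apply: ler_powR2 => //; first exact: metric_ge0.
  by apply: (le_trans (dT z y u)); rewrite lerD2r.
rewrite ler_wpM2l ?exprn_ge0 ?subr_ge0 ?(ltW al1) //.
apply: ler_powR2 => //; first by rewrite addr_ge0 // mulr_ge0.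
by rewrite lerD2l ler_wpM2r // ler_nat.
Qed.

End HeatStep.

(** * Contraction of the energy *)

Lemma powRD_le (R : realType) (p a b : R) : 0 <= p -> 0 <= a -> 0 <= b ->
  (a + b) `^ p <= 2 `^ p * (a `^ p + b `^ p).
Proof.
move=> p0; wlog ab : a b / a <= b => [H a0 b0|a0 b0].
  by case: (leP a b) => [/H->//|/ltW ba]; rewrite addrC [a `^ p + _]addrC H.
apply: (@le_trans _ _ ((2 * b) `^ p)); first by apply: ler_powR2 => //; lra.
by rewrite powRM // ler_wpM2l ?powR_ge0 // lerDr powR_ge0.
Qed.

Section Contraction.
Variables (R : realType) (Y : Type) (d : Y -> Y -> R) (p c : R) (k j : nat).
Variable rho : gen k -> Y -> Y.
Hypotheses (p_gt0 : 0 < p) (c_gt0 : 0 < c).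
Hypotheses (d_metric : is_metric d) (d_convex : midpoint_convex d p c).
Hypotheses (k_gt0 : (0 < k)%N) (j_gt0 : (0 < j)%N) (j_even : ~~ odd j).
Hypothesis rho_iso : isometric_free_action d rho.

Let q : R := (2 * k)%:R ^+ j.

(** [L] stands for the [p]-th power of the modulus. The energy hypothesis bounds the moment at [y],
    [moment_step] bounds its growth at the barycenter, and the logarithmic condition lets the
    Chernoff tail absorb the factor [m.+1 ^ p]. *)
Lemma heat_contraction (K : R) : 0 < K -> exists C D : R, [/\ 0 < C, 0 < D &
  forall (m : nat) (eps theta L : R) (y : Y),
  0 <= L -> 0 < eps <= 1 -> 0 < theta <= 1 -> m.+1%:R ^-1 <= eps ->
  (p + 1) * ln m.+1%:R <= m.+1%:R * (q^-1 ^+ 2 * eps ^+ 2 / 16) ->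
  energy p d rho (j * m) y <= K * L * energy p d rho j y ->
  exists z, energy p d rho j z <= C * (eps * (1 + L) + theta) * energy p d rho j y /\
            d y z `^ p <= D * (1 + L) * energy p d rho j y].
Proof.
(* [D] bounds the displacement of the barycenter; [E] comes from the tail, where the [p]-th power of
   a sum is split at the cost of [2 ^ p]. *)
move=> K0; pose D := (K + 1) / c; pose E := 2 `^ p * (D + 2 * q).
have q0 : 0 < q by rewrite exprn_gt0 // ltr0n muln_gt0.
have D0 : 0 < D by rewrite divr_gt0 // addr_gt0.
have E0 : 0 < E by rewrite mulr_gt0 ?powR_gt0 // addr_gt0 // mulr_gt0.
exists ((2 * K + 3 + E) / (4 * c)), D; split=> //.
  by rewrite divr_gt0 ?mulr_gt0 // !addr_gt0 // mulr_gt0.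
move=> m eps theta L y L0 /andP[e0 e1] /andP[th0 th1] ne lne hE.
have p0 := ltW p_gt0.
have [dxy0 [dC dT]] := d_metric.
have [G GE] : exists G, G = energy p d rho j y by exists (energy p d rho j y).
rewrite -GE in hE *.
have G0 : 0 <= G by rewrite GE; exact: energy_ge0.
(* If the energy vanishes, [theta * G] is not a positive tolerance, but [y] itself serves as [z]. *)
move: G0; rewrite le_eqVlt => /orP[/eqP G0|G0].
  exists y; rewrite -GE -G0 !mulr0; split=> //.
  have -> : d y y = 0 by apply/dxy0.
  by rewrite powR0 // gt_eqF.
have th1G : theta * G <= G by rewrite ler_piMl // ltW.
have [z0 [hz1 hz2 hz3]] := @approx_barycenter R Y d p c k j rho d_metric d_convex k_gt0
  rho_iso m y (theta * G) (mulr_gt0 th0 G0).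
set M := moment d p j rho m y y in hz1 hz2.
have LG0 : 0 <= L * G by rewrite mulr_ge0 // ltW.
have hM : M <= 2 * K * (L * G).
  by rewrite /M moment_diag; move: hE; lra.
have hd : d y z0 `^ p <= D * (1 + L) * G.
  rewrite /D -(ler_pM2l (mulr_gt0 (ltr0n R 2) c_gt0)).
  have -> : 2 * c * ((K + 1) / c * (1 + L) * G) = 2 * (K + 1) * (G + L * G).
    by field; exact: lt0r_neq0.
  by have := mulr_gt0 K0 G0; move: hz2 hM th1G LG0; lra.
exists z0; split=> //.
set n : R := m.+1%:R in ne lne *; have n1 : 1 <= n by rewrite ler1n.
have n0 : 0 < n by rewrite (lt_le_trans ltr01).
(* The largest displacement of [y] by a word of length [j] that the energy allows. *)
pose B := (2 * q * G) `^ p^-1.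
have BE : B `^ p = 2 * q * G.
  rewrite /B -powRrM mulVf ?gt_eqF // powRr1 //.
  by rewrite !mulr_ge0 ?(ltW q0) ?(ltW G0).
have hB (w : j.-tuple (gen k)) : d y (act_word rho w y) <= B.
  have := displacement_le_energy p d rho y w k_gt0; rewrite -/q -GE => h.
  have pV : 0 <= p^-1 by rewrite invr_ge0.
  have := ler_powR2 pV (powR_ge0 _ _) h.
  by rewrite -powRrM mulfV ?gt_eqF // powRr1 // metric_ge0.
have hzy : d z0 y <= d y z0 by rewrite dC.
have e01 : 0 < eps <= 1 by rewrite e0.
have := @moment_step R Y d p k j rho p0 d_metric k_gt0 j_gt0 j_even rho_iso
  m y z0 (d y z0) B eps hzy (powR_ge0 _ _) e01 hB.
rewrite -/q -/n => step.
(* By the logarithmic condition the left side is at most [n^-1]. *)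
have npE : n `^ p * expR (- (n * (q^-1 ^+ 2 * eps ^+ 2 / 16))) <= eps.
  apply: (le_trans _ ne); rewrite -(lnK (n0 : n \is Num.pos)) -expRN.
  rewrite /powR gt_eqF ?expR_gt0 // expRK -expRD ler_expR.
  by rewrite lnK ?posrE //; move: lne; lra.
have np1 : 1 <= n `^ p by have := ler_powR2 p0 ler01 n1; rewrite powR1.
have exp1 : expR (- (n * (q^-1 ^+ 2 * eps ^+ 2 / 16))) <= 
   n `^ p * expR (- (n * (q^-1 ^+ 2 * eps ^+ 2 / 16))).
  by rewrite ler_peMl ?expR_ge0.
set X := expR _ in step npE exp1.
have X0 : 0 <= X by exact: expR_ge0.
have err : (d y z0 + n * B) `^ p * X <= E * (1 + L) * eps * G.
  have h1 : (d y z0 + n * B) `^ p <= 2 `^ p * (d y z0 `^ p + n `^ p * (2 * q * G)).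
    have nB0 : 0 <= n * B := mulr_ge0 (ltW n0) (powR_ge0 _ _).
    have := powRD_le p0 (metric_ge0 y z0 d_metric) nB0.
    by rewrite (powRM p (ltW n0) (powR_ge0 _ _)) -/B BE.
  apply: (le_trans (ler_wpM2r X0 h1)).
  have -> : E * (1 + L) * eps * G = 2 `^ p * ((D + 2 * q) * (1 + L) * eps * G).
    by rewrite /E; ring.
  rewrite -[leLHS]mulrA; apply: ler_wpM2l; first exact: powR_ge0.
  rewrite mulrDl.
  have h2 : d y z0 `^ p * X <= D * (1 + L) * G * eps.
    by apply: ler_pM; rewrite ?powR_ge0 //; exact: le_trans exp1 npE.
  have h3 : n `^ p * (2 * q * G) * X <= 2 * q * G * eps.
    rewrite mulrAC mulrC ler_wpM2l //; first by rewrite !mulr_ge0 ?(ltW q0) ?(ltW G0) ?(ltW e0).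
  have h4 : 0 <= 2 * q * L * G * eps by rewrite !mulr_ge0 ?(ltW q0) ?(ltW G0) ?(ltW e0).
  by move: h2 h3 h4; lra.
rewrite -(ler_pM2l (mulr_gt0 (ltr0n R 4) c_gt0)).
have -> : 4 * c * ((2 * K + 3 + E) / (4 * c) * (eps * (1 + L) + theta) * G)
   = (2 * K + 3 + E) * (eps * (1 + L) + theta) * G.
  by field; exact: lt0r_neq0.
have eM : eps * moment d p j rho m y z0 <= eps * (2 * K * (L * G)) + theta * G.
  apply: (@le_trans _ _ (eps * (2 * K * (L * G) + theta * G))).
    by rewrite ler_wpM2l ?(ltW e0) //; move: hz1 hM; lra.
  by rewrite mulrDr lerD2l ler_piMl // mulr_ge0 ?(ltW th0) ?(ltW G0).
have t1 : 0 <= K * (eps * G) by rewrite !mulr_ge0 ?(ltW q0) ?(ltW G0) ?(ltW e0) ?(ltW K0) ?(ltW th0) ?(ltW E0).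
have t2 : 0 <= K * (theta * G) by rewrite !mulr_ge0 ?(ltW q0) ?(ltW G0) ?(ltW e0) ?(ltW K0) ?(ltW th0) ?(ltW E0).
have t3 : 0 <= eps * G by rewrite !mulr_ge0 ?(ltW q0) ?(ltW G0) ?(ltW e0) ?(ltW K0) ?(ltW th0) ?(ltW E0).
have t4 : 0 <= eps * (L * G) by rewrite !mulr_ge0 ?(ltW q0) ?(ltW G0) ?(ltW e0) ?(ltW K0) ?(ltW th0) ?(ltW E0).
have t5 : 0 <= E * (theta * G) := mulr_ge0 (ltW E0) (mulr_ge0 (ltW th0) (ltW G0)).
apply: (le_trans hz3); move: step err eM t1 t2 t3 t4 t5.
by lra.
Qed.

End Contraction.

(** * Poincaré moduli and the logarithmic rate *)

Section PoincareModulus.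
Variables (R : realType) (p sigma : R) (Y : Type) (d : Y -> Y -> R).

(** The supremum runs over a nonempty family, as the empty subset qualifies, and each modulus is an
    infimum of nonnegative numbers. *)
Lemma poincare_modulus_N_ge0 (N : nat) : (0 <= poincare_modulus_N p sigma d N)%E.
Proof.
pose Z := poincare_modulus p sigma (fun a b : {y : Y | (set0 : set Y) y} => d (sval a) (sval b)).
apply: (@le_trans _ _ Z); last by apply: ereal_sup_ubound; exists set0 => //; exists [::].
by apply: le_ereal_inf_tmp => _ [L [L0 _] <-]; rewrite lee_fin.
Qed.

Lemma poincare_modulus_N_bounded : (poincare_modulus p sigma d < +oo)%E ->
  exists2 L : R, 0 <= L & forall N, (poincare_modulus_N p sigma d N <= L%:E)%E.
Proof.
move=> /ereal_inf_lt[_ [L [L0 PL] <-] _]; exists L => // N.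
apply: ge_ereal_sup => _ [A _ <-].
apply: ge_ereal_inf; exists L%:E => //; exists L => //; split=> // V mu nu rev gap f.
exact: (PL V mu nu rev gap (fun v => sval (f v))).
Qed.

End PoincareModulus.

Lemma ln_eventually_ge (R : realType) (T : R) :
  exists M : nat, forall N : nat, (M <= N)%N -> T <= ln (N%:R : R).
Proof.
have e0 := ltW (expR_gt0 T); have hM := archi_boundP e0.
exists (Num.bound (expR T)) => N hN.
have h : expR T <= N%:R by apply: (le_trans (ltW hM)); rewrite ler_nat.
by rewrite -(expRK T) ler_ln ?posrE ?expR_gt0 // (lt_le_trans (expR_gt0 T)).
Qed.

(** [ln t = 2 * ln (sqrt t) <= 2 * sqrt t], so the quotient is at most [2 / sqrt t]. *)
Lemma lnx_div_x_small (R : realType) (eta : R) : 0 < eta ->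
  exists T : R, 0 < T /\ forall t, T <= t -> ln t / t <= eta.
Proof.
move=> eta0; exists (4 / eta ^+ 2); split; first by rewrite divr_gt0 // exprn_gt0.
move=> t hT; have t0 : 0 < t by apply: lt_le_trans hT; rewrite divr_gt0 // exprn_gt0.
have s0 : 0 < Num.sqrt t by rewrite sqrtr_gt0.
have tE : t = Num.sqrt t ^+ 2 by rewrite sqr_sqrtr // ltW.
set s := Num.sqrt t in s0 tE.
have ls : ln t <= 2 * s.
  by rewrite tE lnXn // -[_ *+ 2]mulr_natl ler_pM2l // ltW // ln_sublinear.
rewrite ler_pdivrMr //; apply: (le_trans ls).
have es : 2 <= eta * s.
  rewrite -(ler_pXn2r (ltn0Sn 1)) ?nnegrE ?mulr_ge0 ?(ltW eta0) ?(ltW s0) // exprMn -tE.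
  by move: hT; rewrite ler_pdivrMr ?exprn_gt0 //; lra.
by rewrite tE expr2 mulrA ler_wpM2r // ltW.
Qed.

(** The [p]-th power of the factor in the limit hypothesis, and the order of magnitude of [eps]. *)
Definition loglog_rate (R : realType) (N : nat) : R := Num.sqrt (ln (ln N%:R) / ln N%:R).

(** For a finite modulus one [L] serves all [N] and the rate tends to zero; otherwise the limit
    hypothesis is raised to the power [p]. *)
Lemma modulus_rate_small (R : realType) (p sigma : R) (Y : Type) (d : Y -> Y -> R) :
  0 < p ->
  ((poincare_modulus p sigma d < +oo)%E \/
   (fun N : nat => ((ln (ln N%:R) / ln N%:R) `^ (1 / (2 * p)))%:E
                   * poincare_modulus_N p sigma d N)%E @ \oo --> (0 : \bar R)) ->
  forall delta : R, 0 < delta -> exists M : nat, forall N : nat, (M <= N)%N ->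
  exists L : R, [/\ 0 <= L, (poincare_modulus_N p sigma d N <= L%:E)%E &
                    loglog_rate R N * (1 + L `^ p) <= delta].
Proof.
move=> p0 hyp.
have rate_small (delta : R) : 0 < delta ->
    exists M : nat, forall N : nat, (M <= N)%N -> 
      0 < ln (ln N%:R) / ln N%:R :> R /\ loglog_rate R N <= delta.
  move=> delta0; have d20 : 0 < delta ^+ 2 by rewrite exprn_gt0.
  have [T [T0 hT]] := lnx_div_x_small d20.
  have [M hM] := ln_eventually_ge (T + 2); exists M => N /hM hN.
  have t2 : 1 < ln (N%:R : R) by move: hN; lra.
  have t0 : 0 < ln (N%:R : R) by move: hN; lra.
  split; first by rewrite divr_gt0 // ln_gt0.
  rewrite -[delta](gtr0_norm delta0) -sqrtr_sqr ler_wsqrtr // hT //.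
  by move: hN; lra.
case: hyp => [/poincare_modulus_N_bounded[L L0 hL]|cv] delta delta0.
  have L1 : 0 < 1 + L `^ p by rewrite ltr_pwDl // powR_ge0.
  have [M hM] := rate_small _ (divr_gt0 delta0 L1).
  by exists M => N /hM[_ hN]; exists L; split; rewrite // -ler_pdivlMr.
have d20 : 0 < delta / 2 by rewrite divr_gt0.
have [M1 hM1] := rate_small _ d20.
pose eta := (delta / 2) `^ p^-1.
have eta0 : 0 < eta by rewrite powR_gt0.
move/fine_cvgP : cv => [[M2 _ hM2] /cvgrPdist_lt/(_ _ eta0)[M3 _ hM3]].
exists (maxn M1 (maxn M2 M3)) => N; rewrite !geq_max => /andP[N1 /andP[N2 N3]].
have [u0 hr] := hM1 N N1; have := hM2 N N2; have := hM3 N N3 => /=.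
rewrite sub0r normrN.
have L0 := poincare_modulus_N_ge0 p sigma d N.
rewrite /loglog_rate in hr *; set u := ln (ln N%:R) / ln N%:R in u0 hr *.
have r0 : 0 < u `^ (1 / (2 * p)) by rewrite powR_gt0.
move: L0; case: poincare_modulus_N => [L||] //= L0.
  rewrite lee_fin in L0; rewrite ger0_norm ?mulr_ge0 ?(ltW r0) ?(ltW u0) // => h _.
  exists L; split=> //; rewrite mulrDr mulr1 [delta]splitr lerD //.
  have -> : Num.sqrt u = (u `^ (1 / (2 * p))) `^ p.
    by rewrite -powRrM -powR12_sqrt ?(ltW r0) ?(ltW u0) //; congr powR; field; rewrite gt_eqF.
  rewrite -powRM ?(ltW r0) ?(ltW u0) //.
  have := ler_powR2 (ltW p0) _ (ltW h); rewrite mulr_ge0 ?(ltW r0) ?(ltW u0) // => /(_ isT).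
  by rewrite /eta -powRrM mulVf ?gt_eqF // powRr1 // (ltW d20).
(* An infinite modulus would make the product infinite, against its eventual finiteness. *)
by rewrite gt0_muley ?lte_fin.
Qed.

(** * Limits of halving iterations *)

Lemma halving_small (R : realType) (A eps : R) : 0 <= A -> 0 < eps ->
  exists n : nat, A / 2 ^+ n < eps.
Proof.
move=> A0 e0; have A0e : 0 <= A / eps by rewrite divr_ge0 // ltW.
exists (Num.bound (A / eps)); rewrite ltr_pdivrMr ?exprn_gt0 // mulrC -ltr_pdivrMr //.
apply: (lt_trans (archi_boundP A0e)).
by rewrite -natrX ltr_nat ltn_expl.
Qed.

(** The iterates move by a geometric series of sum at most [2 * C * F y]. No continuity of [F] is
    assumed: the displacement by [g] tends to zero along the iterates and passes to the limit
    because [g] is an isometry. *)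
Lemma contraction_limit (R : realType) (Y : Type) (d : Y -> Y -> R) (F : Y -> R) (C : R) :
  is_metric d -> complete_metric d -> inhabited Y -> 0 <= C -> (forall y, 0 <= F y) ->
  (forall y, exists z, F z <= F y / 2 /\ d y z <= C * F y) ->
  exists l, forall (g : Y -> Y) (B : R), 0 <= B -> (forall x y, d (g x) (g y) = d x y) ->
    (forall y, d y (g y) <= B * F y) -> g l = l.
Proof.
move=> dM dcomp [y0] C0 F0 /choice[f hf]; have [dxy0 [dC dT]] := dM.
pose u n := iter n f y0.
have Fu n : F (u n) <= F y0 / 2 ^+ n.
  elim: n => [|n IHn]; first by rewrite expr0 divr1.
  apply: (le_trans (hf (u n)).1); rewrite exprSr invfM mulrA.
  by rewrite ler_wpM2r.
have du i y : d y (iter i f y) <= 2 * C * F y.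
  elim: i y => [|i IHi] y.
    by have -> : d y (iter 0 f y) = 0; [apply/dxy0 | rewrite !mulr_ge0].
  rewrite iterSr; apply: (le_trans (dT _ (f y) _)).
  have := ler_wpM2l C0 (hf y).1; have := IHi (f y); have := (hf y).2; lra.
have duN (N n : nat) : (N <= n)%N -> d (u N) (u n) <= 2 * C * F y0 / 2 ^+ N.
  move=> Nn; have -> : u n = iter (n - N) f (u N) by rewrite /u -iterD subnK.
  by apply: (le_trans (du _ _)); rewrite -[leRHS]mulrA ler_wpM2l ?Fu // mulr_ge0.
have [|l hl] := dcomp u.
  move=> eps eps0; have e20 : 0 < eps / 2 by rewrite divr_gt0.
  have A0 : 0 <= 2 * C * F y0 by rewrite !mulr_ge0.
  have [N hN] := halving_small A0 e20; exists N => m n Nm Nn.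
  apply: (le_lt_trans (dT _ (u N) _)); rewrite dC.
  by have := duN N m Nm; have := duN N n Nn; move: hN; lra.
exists l => g B B0 giso gB; apply/dxy0/le_anti; rewrite metric_ge0 // andbT.
apply/ler_addgt0Pr => eps eps0; rewrite add0r.
have e40 : 0 < eps / 4 by rewrite divr_gt0.
have A0 : 0 <= B * F y0 by rewrite mulr_ge0.
have [N1 hN1] := hl _ e40; have [N2 hN2] := halving_small A0 e40.
pose n := maxn N1 N2.
have h1 : d (u n) l < eps / 4 by apply: hN1; rewrite leq_maxl.
have h2 : d (u n) (g (u n)) < eps / 4.
  apply: le_lt_trans hN2; apply: (le_trans (gB _)); rewrite -mulrA ler_wpM2l //.
  apply: (le_trans (Fu n)); rewrite ler_wpM2l // lef_pV2 ?posrE ?exprn_gt0 //.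
  by rewrite ler_weXn2l ?ler1n // leq_maxr.
have t1 := dT (g l) (g (u n)) l; have t2 := dT (g (u n)) (u n) l.
rewrite giso [d l (u n)]dC in t1; rewrite [d (g (u n)) (u n)]dC in t2.
by move: t1 t2 h1 h2; lra.
Qed.

(** * From even words to the whole group *)

Section FixedPoints.
Variables (R : realType) (Y : Type) (d : Y -> Y -> R) (p c : R) (k : nat).
Variable rho : gen k -> Y -> Y.
Hypotheses (p_gt0 : 0 < p) (c_gt0 : 0 < c) (d_metric : is_metric d).
Hypotheses (d_geodesic : geodesic_space d) (d_convex : midpoint_convex d p c).
Hypotheses (k_gt0 : (0 < k)%N) (rho_iso : isometric_free_action d rho).

Lemma fixed_by_even_words (j : nat) (l : Y) : (0 < j)%N -> ~~ odd j ->
  (forall w : j.-tuple (gen k), act_word rho w l = l) ->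
  forall s s', rho s (rho s' l) = l.
Proof.
move=> j0 jev fixj s s'.
(* Padding of length [j - 2], so that [s], [s'] and [w] form a word of length [j]. *)
have [w sw wy] := trivial_even_word rho_iso j./2.-1 k_gt0.
have sz : size [:: s, s' & w] == j.
  rewrite /= sw -doubleS prednK ?even_halfK //.
  by rewrite half_gt0; case: j j0 jev {fixj sw} => [|[]].
by have := fixj (Tuple sz); rewrite /= wy.
Qed.

(** Otherwise the midpoint of [x] and [x'] would lie at distance below [r] from both [y] and [z],
    against the triangle inequality. *)
Lemma equidistant_unique (y z x x' : Y) (r : R) : 2 * r = d y z ->
  d y x = r -> d z x = r -> d y x' = r -> d z x' = r -> x = x'.
Proof.
move=> rE yx zx yx' zx'; have [dxy0 [dC dT]] := d_metric; apply/dxy0.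
apply/eqP; rewrite eq_le metric_ge0 // andbT leNgt; apply/negP => xx'.
have [q hq] := d_convex x x'.
have lt_r v : d v x = r -> d v x' = r -> d v q < r.
  move=> vx vx'; rewrite ltNge; apply/negP => rq.
  have r0 : 0 <= r by rewrite -vx metric_ge0.
  have := ler_powR2 (ltW p_gt0) r0 rq.
  have := hq v; rewrite vx vx'.
  by have := mulr_gt0 c_gt0 (powR_gt0 p xx'); lra.
have := dT y q z; rewrite [d q z]dC.
by have := lt_r y yx yx'; have := lt_r z zx zx'; lra.
Qed.

(* Every generator swaps l and its common image z, so it fixes their midpoint. *)
Lemma fixed_midpoint (l : Y) : (forall s s', rho s (rho s' l) = l) ->
  exists y : Y, forall w, act_word rho w y = y.
Proof.
move=> even; have [dxy0 [dC dT]] := d_metric.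
pose s0 : gen k := (Ordinal k_gt0, false); pose z := rho s0 l.
have lz s : rho s l = z by rewrite -{1}(even (ginv s) s0) (rho_ginv rho_iso).
have zl s : rho s z = l by exact: even.
have [g [g0 [g1 gd]]] := d_geodesic l z.
have h0 : 0 <= (0 : R) <= 1 by rewrite lexx ler01.
have h1 : 0 <= (1 : R) <= 1 by rewrite lexx ler01.
have h2 : 0 <= (2^-1 : R) <= 1 by apply/andP; split; lra.
pose r := d l z / 2; pose m := g 2^-1.
have lm : d l m = r.
  by rewrite -{1}g0 gd // sub0r normrN ger0_norm // mulrC.
have zm : d z m = r.
  rewrite -{1}g1 gd // ger0_norm; last by lra.
  by rewrite /r; field.
have rE : 2 * r = d l z by rewrite /r mulrC divfK.
have ms s : rho s m = m.
  apply/esym/(equidistant_unique rE) => //.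
    by rewrite -(zl s) rho_iso.1.
  by rewrite -(lz s) rho_iso.1.
by exists m; elim=> [//|s w IHw] /=; rewrite IHw.
Qed.

End FixedPoints.

(* The constant E makes the Chernoff tail at most (m + 1)^-(p + 1). *)
Lemma step_parameters (R : realType) (p a b q : R) (N m : nat) :
  0 < p -> 0 < a -> 0 < b -> 0 < q ->
  expR 1 + b + 1 <= ln (N%:R : R) -> a * ln N%:R <= m%:R <= b * ln N%:R ->
  let E := 1 + a^-1 + 32 * (p + 1) / (a * q ^+ 2) in
  let eps := E * loglog_rate R N in
  [/\ 0 < eps, m.+1%:R ^-1 <= eps &
     (p + 1) * ln m.+1%:R <= m.+1%:R * (q ^+ 2 * eps ^+ 2 / 16)].
Proof.
move=> p0 a0 b0 q0 tT /andP[am mb] E eps.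
set t : R := ln N%:R in tT am mb.
have e0 := expR_gt0 (1 : R).
have t1 : 1 < t by have := expR_ge1Dx (1 : R); move: tT; lra.
have t0 : 0 < t by lra.
have lt1 : 1 <= ln t.
  by rewrite -(expRK (1 : R)) ler_ln ?posrE //; move: tT; lra.
set n : R := m.+1%:R.
have nE : n = m%:R + 1 by rewrite /n -natr1.
have n0 : 0 < n by rewrite ltr0n.
have an : a * t <= n by move: am; lra.
(* [t] dominates [b + 1], so [ln n] is at most [2 * ln t]; this 2 and the 16 of the Chernoff
   exponent give the 32 in [E]. *)
have nt2 : n <= t ^+ 2.
  have : (b + 1) * t <= t * t by rewrite ler_pM2r //; move: tT; lra.
  by rewrite expr2; move: mb; lra.
have lnn : ln n <= 2 * ln t.
  by rewrite mulr_natl -lnXn // ler_ln ?posrE ?exprn_gt0.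
set s := loglog_rate R N in eps *.
have u0 : 0 < ln t / t by rewrite divr_gt0 //; lra.
have s0 : 0 < s by rewrite sqrtr_gt0.
have s2 : s ^+ 2 = ln t / t by rewrite sqr_sqrtr // ltW.
have st : t^-1 <= s.
  rewrite -(ler_pXn2r (ltn0Sn 1)) ?nnegrE ?invr_ge0 ?(ltW t0) ?(ltW s0) // s2 expr2.
  rewrite ler_wpM2r ?invr_ge0 ?(ltW t0) //; apply: le_trans lt1.
  by rewrite invf_le1 // ltW.
have aq0 : 0 < a * q ^+ 2 by rewrite mulr_gt0 // exprn_gt0.
have c0 : 0 < 32 * (p + 1) / (a * q ^+ 2) by rewrite divr_gt0 // mulr_gt0 //; lra.
have aV0 : 0 < a^-1 by rewrite invr_gt0.
have E1 : 1 <= E by rewrite /E; lra.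
have E0 : 0 < E by lra.
split; first by rewrite mulr_gt0.
  apply: (@le_trans _ _ ((a * t)^-1)); first by rewrite lef_pV2 ?posrE ?mulr_gt0.
  rewrite invfM ler_pM ?invr_ge0 ?(ltW a0) ?(ltW t0) //.
  by rewrite /E; lra.
have -> : n * (q ^+ 2 * eps ^+ 2 / 16) = (E ^+ 2 * q ^+ 2 / 16) * (n * s ^+ 2).
  by rewrite /eps; field.
have ns : a * ln t <= n * s ^+ 2.
  by rewrite s2 mulrA ler_pdivlMr // mulrAC ler_wpM2r //; lra.
(* The summand 1 in [E] ensures [E <= E ^+ 2]. *)
have E2 : 32 * (p + 1) / (a * q ^+ 2) <= E ^+ 2.
  apply: (@le_trans _ _ E); first by rewrite /E; lra.
  by rewrite expr2 ler_peMl // ltW.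
rewrite ler_pdivrMr // in E2.
have h1 : (E ^+ 2 * q ^+ 2 / 16) * (a * ln t) <= (E ^+ 2 * q ^+ 2 / 16) * (n * s ^+ 2).
  by rewrite ler_wpM2l // divr_ge0 // mulr_ge0 // sqr_ge0.
apply: le_trans h1.
have h2 : 32 * (p + 1) * ln t <= E ^+ 2 * (a * q ^+ 2) * ln t.
  by rewrite ler_wpM2r //; lra.
have h3 : (p + 1) * ln n <= (p + 1) * (2 * ln t) by rewrite ler_wpM2l //; lra.
by move: h2 h3; lra.
Qed.

(** * Choice of the parameters and the fixed point *)

Theorem theorem7p6 (R : realType)
  (T : nat -> finType) (e : forall i, rel (T i)) (dg : nat) (cg sigma p : R)
  (k j : nat) (alpha : forall i, T i -> T i -> j.-tuple (gen k))
  (Y : Type) (dY : Y -> Y -> R) :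
  graph_family e dg cg sigma -> 0 < cg -> 0 < sigma -> 2 <= p ->
  (0 < k)%N -> (0 < j)%N -> ~~ odd j ->
  is_labeling e alpha -> property_P p sigma e alpha ->
  is_metric dY -> inhabited Y -> complete_metric dY -> geodesic_space dY ->
  p_uniformly_convex dY p ->
  ((poincare_modulus p sigma dY < +oo)%E \/
   (fun N : nat => ((ln (ln N%:R) / ln N%:R) `^ (1 / (2 * p)))%:E
                   * poincare_modulus_N p sigma dY N)%E @ \oo --> (0 : \bar R)) ->
  forall rho : gen k -> Y -> Y, alpha_action dY e alpha rho ->
  exists y : Y, forall w : seq (gen k), act_word rho w y = y.
Proof.
move=> _ _ _ p2 k0 j0 jev _ [a [b [K [a0 [b0 [K0 hP]]]]]] dM Yinh dcomp geo conv hyp rho act.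
have p0 : 0 < p by lra.
have rho_iso := act.1.
have [c c0 midc] := p_uniformly_convex_midpoint geo conv.
pose q : R := (2 * k)%:R ^+ j.
have q0 : 0 < q by rewrite exprn_gt0 // ltr0n muln_gt0.
have [C [D [C0 D0 step]]] := heat_contraction p0 c0 dM midc k0 j0 jev rho_iso K0.
pose E := 1 + a^-1 + 32 * (p + 1) / (a * q^-1 ^+ 2).
have E1 : 0 < E.
  by rewrite !addr_gt0 ?invr_gt0 // divr_gt0 ?mulr_gt0 ?exprn_gt0 ?invr_gt0 //; lra.
(* Contracting the energy by [2 ^ -p] halves its [p]-th root [F]. *)
pose eta : R := 2^-1 `^ p.
have eta0 : 0 < eta by rewrite powR_gt0.
(* [theta] and [delta] each contribute at most [eta / 2] to the contraction factor; the other
   entries of the minima keep [theta] and [eps] at most 1. *)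
pose theta := Num.min 1 (eta / 2 / C).
have th0 : 0 < theta by rewrite lt_min ltr01 !divr_gt0.
pose delta := Num.min E^-1 (eta / 2 / C / E).
have delta0 : 0 < delta by rewrite lt_min invr_gt0 E1 !divr_gt0.
have [M1 hM1] := modulus_rate_small p0 hyp delta0.
have [M2 hM2] := ln_eventually_ge (expR 1 + b + 1).
(* One [N] is fixed for all [y], while the time [m] may depend on [y]; hence the constants of the
   contraction are uniform. *)
have [i [hi hm]] := hP Y dY dM rho act (maxn M1 M2).
set N := #|T i| in hi hm.
move: hi; rewrite geq_max => /andP[/hM1[L [L0 hL hrate]] /hM2 hN].
pose G (y : Y) : R := energy p dY rho j y.
have G0 y : 0 <= G y by exact: energy_ge0.
have Lp0 : 0 <= L `^ p by exact: powR_ge0.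
have contr y : exists z, G z <= eta * G y /\ dY y z `^ p <= D * (1 + L `^ p) * G y.
  have [m [abm hen]] := hm y.
  have iq0 : 0 < q^-1 by rewrite invr_gt0.
  have [eps0 epsn epsl] := step_parameters p0 a0 b0 iq0 hN abm.
  rewrite -/E in eps0 epsn epsl; set eps := E * _ in eps0 epsn epsl.
  have epsL : eps * (1 + L `^ p) <= E * delta by rewrite -mulrA ler_wpM2l // ltW.
  have eps1 : eps <= 1.
    have h1 : eps <= eps * (1 + L `^ p) by rewrite ler_peMr ?(ltW eps0) // lerDl.
    apply: (le_trans h1); apply: (le_trans epsL).
    by rewrite -(mulfV (lt0r_neq0 E1)) ler_wpM2l ?(ltW E1) // ge_min lexx.
  have hen' : energy p dY rho (j * m) y <= K * L `^ p * energy p dY rho j y.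
    rewrite -lee_fin; apply: (le_trans hen); rewrite !EFinM.
    apply: lee_wpmul2r; first by rewrite lee_fin; exact: energy_ge0.
    apply: lee_wpmul2l; first by rewrite lee_fin ltW.
    rewrite -[(L `^ p)%:E]/(poweR L%:E p).
    apply: gt0_ler_poweR => //; first exact: ltW.
      by rewrite in_itv /= poincare_modulus_N_ge0 leey.
    by rewrite in_itv /= lee_fin L0 leey.
  have eps01 : 0 < eps <= 1 by rewrite eps0.
  have th01 : 0 < theta <= 1 by rewrite th0 ge_min lexx.
  have [z [hz1 hz2]] := step m eps theta _ y Lp0 eps01 th01 epsn epsl hen'.
  exists z; split=> //; apply: (le_trans hz1); rewrite ler_wpM2r //.
  have th2 : C * theta <= eta / 2.
    by rewrite mulrC -ler_pdivlMr // ge_min lexx orbT.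
  have ep2 : C * (eps * (1 + L `^ p)) <= eta / 2.
    rewrite mulrC -ler_pdivlMr //; apply: (le_trans epsL).
    by rewrite mulrC -ler_pdivlMr // ge_min lexx orbT.
  by rewrite mulrDr; move: th2 ep2; lra.
pose F (y : Y) : R := G y `^ p^-1.
have pV0 : 0 <= p^-1 by rewrite invr_ge0 ltW.
have rootK (x : R) : 0 <= x -> (x `^ p) `^ p^-1 = x.
  by move=> x0; rewrite -powRrM mulfV ?gt_eqF // powRr1.
pose A := D * (1 + L `^ p).
have A0 : 0 <= A by rewrite mulr_ge0 ?(ltW D0) // addr_ge0.
have [l hl] : exists l, forall (g : Y -> Y) (B : R), 0 <= B ->
    (forall x y, dY (g x) (g y) = dY x y) -> (forall y, dY y (g y) <= B * F y) -> g l = l.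
  apply: (@contraction_limit R Y dY F (A `^ p^-1)) => //; try by move=> *; exact: powR_ge0.
  move=> y; have [z [z1 z2]] := contr y; exists z; split.
    have := ler_powR2 pV0 (G0 z) z1.
    by rewrite powRM ?(ltW eta0) // rootK ?invr_ge0 // mulrC.
  have := ler_powR2 pV0 (powR_ge0 _ _) z2.
  by rewrite rootK ?metric_ge0 // powRM.
apply: (fixed_midpoint p0 c0 dM geo midc k0 rho_iso (l := l)).
apply: (fixed_by_even_words k0 rho_iso j0 jev) => w.
apply: (hl _ ((2 * q) `^ p^-1)); first exact: powR_ge0.
  by move=> x y; exact: (act_word_isometry rho_iso).
move=> y; have h := displacement_le_energy p dY rho y w k0.
have := ler_powR2 pV0 (powR_ge0 _ _) h.
by rewrite rootK ?metric_ge0 // powRM ?G0.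
Qed.
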